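(* Let $n\ge2$ and let $q=\Omega(n^{2+\epsilon})$ for some $\epsilon>0$. Then $$q^2+n-1-o(q^2)\ \le\ P_q(n,n-1)\ \le\ q^2+n-1 .$$ Here $q=\Omega(n^{2+\epsilon})$ means $q\ge c\,n^{2+\epsilon}$ for some fixed constants $c,\epsilon>0$, and $o(q^2)$ is as $q\to\infty$.
   Context: Let $\Sigma$ be an alphabet with $q$ symbols. A sequence $s=s_0\cdots s_{N-1}$ over $\Sigma$ is an $(n,d)_q$-robust positioning sequence if for all $0\le i<j\le N-n$ the Hamming distance between $s_i\cdots s_{i+n-1}$ and $s_j\cdots s_{j+n-1}$ is at least $d$. $P_q(n,d)$ denotes the maximum length $N$ of an $(n,d)_q$-robust positioning sequence. *)

(* Defs.v *)
From mathcomp Require Import all_boot all_order all_algebra.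
From mathcomp Require Import all_classical all_reals all_analysis.
From mathcomp Require Import zify.
Import numFieldNormedType.Exports.

Set Implicit Arguments.
Unset Strict Implicit.
Unset Printing Implicit Defensive.

Definition window (Sigma : eqType) (n : nat) (s : seq Sigma) (i : nat) :
  seq Sigma := take n (drop i s).

(* Intended for words of equal length: [zip] truncates to the shorter one. *)
Definition hamming (Sigma : eqType) (u v : seq Sigma) : nat :=
  count (fun p => p.1 != p.2) (zip u v).

(* [j + n <= size s] is [j <= N - n] without truncated subtraction, so every
   sequence of length at most [n] is robust. *)
Definition robust_positioning (Sigma : eqType) (n d : nat) (s : seq Sigma) :
  Prop :=
  forall i j : nat, i < j -> j + n <= size s ->
    d <= hamming (window n s i) (window n s j).

Definition is_max_length (q n d N : nat) : Prop :=
  (exists s : seq 'I_q, robust_positioning n d s /\ size s = N) /\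
  (forall s : seq 'I_q, robust_positioning n d s -> size s <= N).

(* The maximum exists whenever [0 < d] (lemma [max_lengthP]); for [d = 0]
   and [0 < q] lengths are unbounded and the value is the default [0]. *)
Definition max_length (q n d : nat) : nat :=
  xget 0 [set N | is_max_length q n d N]%classic.

Lemma hamming_refl (Sigma : eqType) (u : seq Sigma) : hamming u u = 0.
Proof. by rewrite /hamming; elim: u => //= x u ->; rewrite eqxx. Qed.

Lemma robust_size_bound (q n d : nat) (s : seq 'I_q) :
  0 < d -> robust_positioning n d s -> size s <= q ^ n + n.
Proof.
move=> d0 rs; have [sn|ns] := ltnP (size s) n.
  by rewrite (leq_trans (ltnW sn))// leq_addl.
have szw (i : 'I_(size s - n).+1) : size (window n s i) == n.
  have ni : n <= size s - i by have := ltn_ord i; lia.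
  by rewrite /window size_take_min size_drop; apply/eqP/minn_idPl.
pose f (i : 'I_(size s - n).+1) : n.-tuple 'I_q := Tuple (szw i).
have neq (i j : 'I_(size s - n).+1) : i < j -> f i <> f j.
  move=> ij /(congr1 val)/= e.
  have jn : j + n <= size s by have := ltn_ord j; lia.
  by have := rs _ _ ij jn; rewrite e hamming_refl leqNgt d0.
have injf : injective f.
  by move=> i j e; apply/val_inj; case: (ltngtP i j) => // /neq; rewrite e.
have := leq_card f injf; rewrite card_ord card_tuple card_ord.
by move: (q ^ n) => m; lia.
Qed.

Lemma max_lengthP (q n d : nat) : 0 < d -> is_max_length q n d (max_length q n d).
Proof.
move=> d0; apply: (@xgetPex _ 0 [set N | is_max_length q n d N]%classic).
pose ok N := `[< exists s : seq 'I_q, robust_positioning n d s /\ size s = N >].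
have ex : exists N, ok N.
  exists 0; apply/asboolP; exists [::]; split=> // i j ij.
  by rewrite /= leqn0 addn_eq0 => /andP[/eqP j0]; rewrite j0 in ij.
have bd N : ok N -> N <= q ^ n + n.
  by move=> /asboolP[s [rs <-]]; exact: robust_size_bound rs.
case: (ex_maxnP ex bd) => N /asboolP okN maxN; exists N; split=> // s rs.
by apply: maxN; apply/asboolP; exists s.
Qed.

(* Main.v *)
Require Import Defs.
From mathcomp Require Import all_boot all_order all_algebra.
From mathcomp Require Import all_solvable all_field.
From mathcomp Require Import all_classical all_reals all_analysis.
From mathcomp Require Import zify lra.
Import Order.TTheory GRing.Theory Num.Theory.
Import numFieldNormedType.Exports.

Set Implicit Arguments.
Unset Strict Implicit.
Unset Printing Implicit Defensive.

(* A sequence is [(n, n - 1)]-robust as soon as, for each distance [0 < t < n],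
   the pairs [(s_i, s_(i+t))] are pairwise distinct; for the upper bound, the
   pairs of neighbours [(s_i, s_(i+1))] starting a window are pairwise distinct.

   For the lower bound, let [F] and [G] be finite fields with generators [z1]
   and [z2] of their unit groups, and consider the template
   [g_i = (z1 ^ i, z2 ^ e_i)] in [F * G] for [i < (#|F| - 1) * (#|G| - 1)],
   where the exponents [e_i] make the differences [g_(i+t) - g_i] pairwise
   distinct for each [t < n].  Then all translates [g + b] of the template
   together have pairwise distinct pairs at each distance, and they can be
   concatenated with [n - 1] separating symbols taken from a reserved alphabet
   of size about [n * #|F|].  Taking [#|F| = 2 ^ a] and [#|G| = 3 ^ b] avoids any
   information on gaps between primes: since [ln 2 / ln 3] is irrational,
   [2 ^ a * 3 ^ b] can be made [(1 - o(1)) q] with both factors of order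
   [sqrt q], and the reserved alphabet has [o(q)] symbols because
   [n = o(sqrt q)]. *)

(** * Products of a power of 2 and a power of 3 near a given number *)

(** Bernoulli's inequality [(1 + 1/k) ^ s >= 1 + s/k] with denominators cleared. *)
Lemma bernoulli_nat (k s : nat) : (k + s) * k ^ s <= k * k.+1 ^ s.
Proof.
elim: s => [|s IHs]; first by rewrite addn0 !expn0.
have := leq_mul2r k.+1 ((k + s) * k ^ s) (k * k.+1 ^ s); rewrite IHs orbT.
rewrite !expnSr; move: (k ^ s) (k.+1 ^ s) => x y; nia.
Qed.

Lemma expn2_neq_expn3 (u v : nat) : 0 < u -> 2 ^ u <> 3 ^ v.
Proof.
by case: u => // u _ /(congr1 odd); rewrite !oddX orbT.
Qed.

(* Subtractive Euclidean algorithm on [ln (2 ^ u / 3 ^ v)] and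
   [ln (3 ^ y / 2 ^ x)]: as long as both ratios exceed [1 + 1 / k], each step
   divides their product by more than [1 + 1 / k]. *)
Lemma expn23_ratio_euclid (k s u v x y : nat) :
  3 ^ v < 2 ^ u -> 2 ^ x < 3 ^ y ->
  2 ^ u * 3 ^ y * k ^ s <= k.+1 ^ s * (2 ^ x * 3 ^ v) ->
  (exists u v, 3 ^ v < 2 ^ u /\ k * 2 ^ u <= k.+1 * 3 ^ v) \/
  (exists x y, 2 ^ x < 3 ^ y /\ k * 3 ^ y <= k.+1 * 2 ^ x).
Proof.
elim: s u v x y => [|s IHs] u v x y uv xy h.
  by move: h; rewrite !expn0; nia.
case: (leqP (k * 2 ^ u) (k.+1 * 3 ^ v)) => hu; first by left; exists u, v.
case: (leqP (k * 3 ^ y) (k.+1 * 2 ^ x)) => hy; first by right; exists x, y.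
have u0 : 0 < u by case: u uv {hu h} => //; rewrite expn0 ltnS leqn0 expn_eq0.
have := @expn2_neq_expn3 (u + x) (v + y); rewrite addn_gt0 u0 => /(_ isT) ne.
rewrite !expnSr in h.
have [lt|gt] : 3 ^ (v + y) < 2 ^ (u + x) \/ 2 ^ (u + x) < 3 ^ (v + y) by lia.
- apply: (IHs (u + x) (v + y) x y) => //.
  suff : 2 ^ u * k ^ s <= k.+1 ^ s * 3 ^ v.
    move=> h1; rewrite !expnD.
    by have := leq_mul h1 (leqnn (2 ^ x * 3 ^ y)); lia.
  have p0 : 0 < k * 3 ^ y by lia.
  rewrite -(leq_pmul2r p0).
  have := leq_mul (leqnn (k.+1 ^ s * 3 ^ v)) (ltnW hy); lia.
- apply: (IHs u v (u + x) (v + y)) => //.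
  suff : 3 ^ y * k ^ s <= k.+1 ^ s * 2 ^ x.
    move=> h1; rewrite !expnD.
    by have := leq_mul h1 (leqnn (2 ^ u * 3 ^ v)); lia.
  have p0 : 0 < k * 2 ^ u by lia.
  rewrite -(leq_pmul2r p0).
  have := leq_mul (leqnn (k.+1 ^ s * 2 ^ x)) (ltnW hu); lia.
Qed.

Lemma exists_last (P : pred nat) (M : nat) :
  P 0 -> ~~ P M -> exists2 i, i < M & P i && ~~ P i.+1.
Proof.
move=> P0; elim: M => [|M IHM]; first by rewrite P0.
case: (boolP (P M)) => [PM nP|/IHM[i iM Pi] _]; first by exists M; rewrite ?PM.
by exists i; rewrite // ltnW.
Qed.

Lemma expn23_ratio (k : nat) : 0 < k ->
  exists u v, 3 ^ v < 2 ^ u /\ k * 2 ^ u <= k.+1 * 3 ^ v.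
Proof.
move=> k0.
(* The ratios [2/1] and [3/2] have product [3], and [(1 + 1/k) ^ (2k) >= 3] by Bernoulli. *)
have h : 2 ^ 1 * 3 ^ 1 * k ^ k.*2 <= k.+1 ^ k.*2 * (2 ^ 1 * 3 ^ 0).
  have := bernoulli_nat k k.*2; move: (k ^ _) (k.+1 ^ _) => x y; nia.
case: (expn23_ratio_euclid _ _ h) => // -[x [y [xy hy]]].
(* If the small ratio is [r = 3 ^ y / 2 ^ x], take the last [i] with [r ^ i < 2]; then
   [1 < 2 / r ^ i <= r]. *)
have [||i _ /andP[lti]] := @exists_last
  (fun i => 3 ^ (y * i) < 2 ^ (x * i).+1) (2 ^ x) _ _.
- by rewrite !muln0.
- have := bernoulli_nat (2 ^ x) (2 ^ x).
  rewrite addnn -muln2 mulnAC -mulnA leq_pmul2l ?expn_gt0// -leqNgt => h2.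
  rewrite expnSr expnM; apply: leq_trans h2 _.
  by rewrite expnM leq_exp2r ?expn_gt0.
rewrite -leqNgt !mulnS => gti.
exists (x * i).+1, (y * i); split=> //.
move: gti; rewrite -addnS !expnD => gti.
have p0 : 0 < 3 ^ y * 2 ^ x by rewrite muln_gt0 !expn_gt0.
rewrite -(leq_pmul2r p0).
have := leq_mul hy gti; lia.
Qed.

(** A coarse choice within a factor 2 of [k * q / k.+1] is multiplied by [2 ^ u / 3 ^ v] as long as
    it does not exceed that bound. The gap up to [q] leaves room for [2 ^ a * n], since
    [k * n < 3 ^ b]. *)
Lemma expn23_approx (k : nat) : 0 < k -> exists K, forall q n, 0 < n ->
  K * n ^ 2 <= q -> exists a b,
  [/\ k * n < 3 ^ b, 3 ^ b <= 2 ^ a, 2 ^ a * (3 ^ b + n) <= q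
    & k ^ 2 * q <= k.+1 ^ 2 * (2 ^ a * 3 ^ b)].
Proof.
move=> k0; have [u [v [uv hk]]] := expn23_ratio k0.
(* [36 = 4 * 9] comes from [q < 4 * 9 ^ b0.+1] below, and [9 ^ (v * M)] pays for at most [M]
   divisions of [3 ^ b0] by [3 ^ v]. *)
pose M := 3 ^ v; exists (36 * 9 ^ (v * M) * k ^ 2) => q n n0 Kq.
have Kq' : 36 * 9 ^ (v * M) <= q.
  apply: leq_trans Kq; rewrite -mulnA leq_pmulr// muln_gt0 !expn_gt0 k0 n0//.
have e9 b : 9 ^ b = 3 ^ b * 3 ^ b by rewrite -expnMn.
have [||b0 _ /andP[b0q]] := @exists_last (fun b => 4 * 9 ^ b <= q) q _ _.
- have : 0 < 9 ^ (v * M) by rewrite expn_gt0.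
  by move=> ?; lia.
- by rewrite -ltnNge; have := ltn_expl q (isT : 1 < 9); lia.
rewrite -ltnNge expnS => qb0.
have vMb0 : v * M < b0.+1.
  have : 9 ^ (v * M) < 9 ^ b0.+1 by rewrite expnS; lia.
  by rewrite ltn_exp2l.
have [||a0 _ /andP[a0q]] := @exists_last
  (fun a => 2 ^ a * 3 ^ b0 * k.+1 <= k * q) (k * q) _ _.
- move: b0q; rewrite e9 expn0 mul1n.
  have : 0 < 3 ^ b0 by rewrite expn_gt0.
  by move=> ? ?; nia.
- rewrite -ltnNge; have := ltn_expl (k * q) (isT : 1 < 2).
  have : 0 < 3 ^ b0 by rewrite expn_gt0.
  by move: (k * q) => z; move: (2 ^ z) (3 ^ b0) => x y ? ?; nia.
rewrite -ltnNge expnS => qa0.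
(* By Bernoulli [(2 ^ u / 3 ^ v) ^ M >= 2], so fewer than [M] corrections fit. *)
have [||i iM /andP[iq]] := @exists_last
  (fun i => 2 ^ (a0 + u * i) * 3 ^ b0 * k.+1 <= k * q * 3 ^ (v * i)) M _ _.
- by rewrite !muln0 addn0 muln1.
- rewrite -ltnNge expnD.
  have := bernoulli_nat M M.
  rewrite addnn -muln2 mulnAC -mulnA leq_pmul2l ?expn_gt0// => h2.
  have h3 : M ^ M * 2 <= 2 ^ (u * M).
    by apply: leq_trans h2 _; rewrite expnM leq_exp2r ?expn_gt0.
  rewrite (expnM 3) -/M.
  have M0 : 0 < M ^ M by rewrite !expn_gt0.
  have h4 : k * q * M ^ M < 2 * 2 ^ a0 * 3 ^ b0 * k.+1 * M ^ M by rewrite ltn_pmul2r.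
  have := leq_mul (leqnn (2 ^ a0 * 3 ^ b0 * k.+1)) h3.
  by move: h4; lia.
rewrite -ltnNge => iq1.
have vib : v * i <= b0.
  by rewrite -ltnS (leq_ltn_trans _ vMb0)// leq_mul2l ltnW ?orbT.
exists (a0 + u * i), (b0 - v * i).
have e3 : 3 ^ b0 = 3 ^ (b0 - v * i) * 3 ^ (v * i) by rewrite -expnD subnK.
have p0 : 0 < 3 ^ (v * i) by rewrite expn_gt0.
have pv0 : 0 < 3 ^ v by rewrite expn_gt0.
move: iq iq1; rewrite (mulnS u) (mulnS v) addnCA (expnD 2 u) (expnD 3 v).
set q1 := 2 ^ _; set q2 := 3 ^ (b0 - _) in e3 *.
rewrite e3 => iq iq1.
have {}iq : q1 * q2 * k.+1 <= k * q by rewrite -(leq_pmul2r p0); lia.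
have {iq1} qlt : k * q * 3 ^ v < 2 ^ u * q1 * q2 * k.+1.
  by rewrite -(ltn_pmul2r p0); lia.
have key : k ^ 2 * q <= k.+1 ^ 2 * (q1 * q2).
  rewrite -(leq_pmul2r pv0).
  have h1 := leq_mul (leqnn k) (ltnW qlt).
  have h2 := leq_mul hk (leqnn (q1 * q2 * k.+1)).
  by rewrite -!mulnn; lia.
have knq2 : k * n < q2.
  rewrite -(@ltn_exp2r _ _ 2)//.
  have h9 : 3 ^ (v * i) * 3 ^ (v * i) <= 9 ^ (v * M).
    by rewrite -e9 leq_exp2l// leq_mul2l ltnW ?orbT.
  have P0 : 0 < 9 ^ (v * M) by rewrite expn_gt0.
  have h10 : 36 * 9 ^ (v * M) * (k * n) ^ 2 < 36 * 9 ^ (v * M) * q2 ^ 2.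
    rewrite expnMn mulnA; apply: leq_ltn_trans Kq _; apply: leq_trans qb0 _.
    rewrite e9 e3 -mulnn.
    have := leq_mul (leqnn (q2 * q2)) h9; lia.
  by move: h10; rewrite ltn_pmul2l// muln_gt0 P0.
have q20 : 0 < q2 by rewrite expn_gt0.
split=> //.
- have h1 : k ^ 2 * q <= k ^ 2 * (4 * (q1 * q2)).
    by apply: leq_trans key _; move: (q1 * q2) => z; rewrite -!mulnn; nia.
  have h2 : q <= 4 * (q1 * q2) by rewrite leq_pmul2l ?expn_gt0 ?k0 in h1.
  have h3 : 4 * (q2 * q2) <= q.
    by apply: leq_trans b0q; rewrite e9 e3 leq_pmul2l// leq_mul// leq_pmulr.
  by rewrite -(leq_pmul2r q20); lia.
- rewrite -(leq_pmul2l k0); apply: leq_trans iq.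
  have := leq_mul (leqnn q1) (ltnW knq2); lia.
Qed.

(** * Construction of long robust sequences *)

Lemma count_le1 (T : Type) (x0 : T) (p : pred T) (s : seq T) :
  (forall a b, a < b -> b < size s -> p (nth x0 s a) -> ~~ p (nth x0 s b)) ->
  count p s <= 1.
Proof.
elim: s => //= x s IHs h.
have hs : count p s <= 1.
  by apply: IHs => a b ab bs; exact: (h a.+1 b.+1).
case: (boolP (p x)) => px //=.
suff : ~~ has p s by rewrite has_count; lia.
apply/negP => /(has_nthP x0)[b bs pb].
by have := h 0 b.+1 isT bs px; rewrite /= pb.
Qed.

Lemma robust_of_pairs (T : eqType) (x0 : T) (n : nat) (s : seq T) :
  (forall t i j, 0 < t < n -> i < j -> j + t < size s ->
    nth x0 s i = nth x0 s j -> nth x0 s (i + t) <> nth x0 s (j + t)) ->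
  robust_positioning n (n - 1) s.
Proof.
move=> h i j ij jn.
have szw k : k <= j -> size (window n s k) = n.
  by move=> kj; rewrite /window size_take_min size_drop; lia.
have nthw k a : a < n -> nth x0 (window n s k) a = nth x0 s (k + a).
  by move=> an; rewrite /window nth_take// nth_drop.
rewrite /hamming; set z := zip _ _.
have szz : size z = n by rewrite size_zip !szw ?minnn// ltnW.
have := count_predC (fun p => p.1 != p.2) z.
suff : count (predC (fun p : T * T => p.1 != p.2)) z <= 1 by rewrite szz; lia.
apply: (@count_le1 _ (x0, x0)) => a b ab bz.
have an : a < n by lia.
have bn : b < n by lia.
rewrite !nth_zip ?szw ?(ltnW ij)//= !nthw// !negbK => /eqP ea.
have := h (b - a) (i + a) (j + a); rewrite -!addnA subnKC ?(ltnW ab)//.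
move=> hab; apply/eqP; apply: hab => //; lia.
Qed.

(** * Upper bound by pigeonhole on pairs of neighbours *)

Lemma robust_size_le (q n : nat) (s : seq 'I_q) : 1 < n ->
  robust_positioning n (n - 1) s -> size s < q ^ 2 + n.
Proof.
move=> n1 rs; have [sn|ns] := ltnP (size s) n; first by lia.
have q0 : 0 < q by case: s ns {rs} => [|[i iq] _ _] /=; lia.
pose x0 := Ordinal q0.
pose f (i : 'I_(size s - n).+1) := (nth x0 s i, nth x0 s i.+1).
have neq (i j : 'I_(size s - n).+1) : i < j -> f i <> f j.
  move=> ij [e1 e2].
  have jn : j + n <= size s by have := ltn_ord j; lia.
  (* Two windows starting with the same pair differ in at most [n - 2] places. *)
  have := rs _ _ ij jn; apply/negP; rewrite -ltnNge.
  have dw (k : nat) : k <= j -> exists2 u,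
      window n s k = [:: nth x0 s k, nth x0 s k.+1 & u] & size u = n - 2.
    move=> kj; exists (take (n - 2) (drop k.+2 s)).
      have k1 : k.+1 < size s by lia.
      rewrite /window (drop_nth x0 (ltnW k1)) (drop_nth x0 k1).
      by rewrite -[in LHS](subnKC n1).
    by rewrite size_take_min size_drop; lia.
  have [u -> su] := dw i (ltnW ij); have [v -> sv] := dw j (leqnn j).
  rewrite /hamming /= e1 e2 !eqxx !add0n.
  by apply: leq_ltn_trans (count_size _ _) _; rewrite size_zip su sv; lia.
have injf : injective f.
  by move=> i j e; apply/val_inj; case: (ltngtP i j) => // /neq; rewrite e.
have := leq_card f injf; rewrite card_prod !card_ord; lia.
Qed.

(** * Templates from primitive roots of finite fields *)

Lemma finField_prim_root (F : finFieldType) : 2 < #|F| ->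
  exists z : F, (#|F|.-1.-primitive_root z)%R.
Proof.
move=> F2; pose rs := enum (predC1 (0%R : F)).
have /hasP[z _ zP] : has (#|F|.-1.-primitive_root)%R rs.
  apply: has_prim_root.
  - lia.
  - apply/allP => x; rewrite mem_enum inE => x0.
    rewrite unity_rootE; apply/eqP/(mulfI x0).
    rewrite mulr1 -exprS prednK ?expf_card//; lia.
  - exact: enum_uniq.
  - by rewrite -cardE cardC1.
by exists z.
Qed.

Lemma subr_prim_expr_neq0 (F : fieldType) (z : F) (N i j : nat) :
  (N.-primitive_root z)%R -> i < j -> j < i + N -> (z ^+ j - z ^+ i != 0)%R.
Proof.
move=> zP ij jN; rewrite subr_eq0 (eq_prim_root_expr zP).
by rewrite eqn_mod_dvd ?(ltnW ij)// gtnNdvd; lia.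
Qed.

(* The exponent [(i * D) %/ N1] of [z2] grows by [D = 1 %[mod N2]] over a full
   period [N1] of [z1], so that the [N2] positions sharing a given power of [z1]
   carry differences in [G] that run through all nonzero multiples of one of
   them. *)
Lemma template_inj (F G : fieldType) (z1 : F) (z2 : G) (N1 N2 D n t i j : nat) :
    (N1.-primitive_root z1)%R -> (N2.-primitive_root z2)%R ->
    D = 1 %[mod N2] -> N1 <= D <= N1.*2 -> n.*2 < N2 <= N1 -> 0 < t <= n ->
    i < N1 * N2 -> j < N1 * N2 ->
    (z1 ^+ (i + t) - z1 ^+ i = z1 ^+ (j + t) - z1 ^+ j)%R ->
    (z2 ^+ (((i + t) * D) %/ N1) - z2 ^+ ((i * D) %/ N1) =
     z2 ^+ (((j + t) * D) %/ N1) - z2 ^+ ((j * D) %/ N1))%R ->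
  i = j.
Proof.
move=> z1P z2P D1 DN1 N2N1 tn.
wlog ij : i j / i <= j => [wl iN jN e1 e2|].
  by case: (leqP i j) => [|/ltnW] ij; [exact: wl|apply/esym/wl].
move=> iN jN e1 e2.
have N10 : 0 < N1 by lia.
(* Since [N1 <= D <= 2 * N1], over [t] positions the exponent grows by at least [1] and at most
   [2 * t < N2], so the differences in [G] are nonzero. *)
have e_le m : (m * D) %/ N1 < ((m + t) * D) %/ N1 /\
    ((m + t) * D) %/ N1 < (m * D) %/ N1 + N2.
  split.
    rewrite -[(m * D %/ N1).+1]add1n -divnMDl//; apply: leq_div2r; nia.
  apply: (@leq_ltn_trans ((m * D) %/ N1 + t.*2)); last by lia.
  rewrite [_ %/ _ + _]addnC -divnMDl//; apply: leq_div2r; nia.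
(* The first coordinate determines the position modulo [N1], as [z1 ^ t - 1] is nonzero. *)
have {e1} [k jE] : exists k, j = i + N1 * k.
  have e1' : i == j %[mod N1].
    have h m : (z1 ^+ (m + t) - z1 ^+ m = z1 ^+ m * (z1 ^+ t - z1 ^+ 0))%R.
      by rewrite exprD expr0 mulrBr mulr1.
    rewrite -(eq_prim_root_expr z1P); apply/eqP.
    move: e1; rewrite !h; apply: mulIf.
    by apply: (subr_prim_expr_neq0 z1P); lia.
  rewrite eq_sym eqn_mod_dvd// in e1'; case/dvdnP: e1' => k jik.
  by exists k; rewrite mulnC -jik subnKC.
have kN2 : k < N2 by rewrite -(ltn_pmul2l N10); lia.
have eE m : ((m + N1 * k) * D) %/ N1 = (m * D) %/ N1 + D * k.
  have -> : (m + N1 * k) * D = D * k * N1 + m * D by lia.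
  by rewrite divnMDl// addnC.
have zD : (z2 ^+ (D * k) = z2 ^+ k)%R.
  by apply/eqP; rewrite (eq_prim_root_expr z2P) -modnMml D1 modnMml mul1n.
move: e2; rewrite jE addnAC !eE !exprD zD -mulrBl.
have [lt1 lt2] := e_le i.
set d := (_ - _)%R => e2.
have d0 : d != 0%R by exact: subr_prim_expr_neq0 z2P lt1 lt2.
have /eqP : (z2 ^+ 0 = z2 ^+ k)%R.
  by rewrite expr0; apply: (mulfI d0); rewrite mulr1.
rewrite (eq_prim_root_expr z2P) mod0n modn_small// => /eqP <-.
by rewrite muln0 addn0.
Qed.

Lemma addrBD (V : zmodType) (x y b : V) : (x + b - (y + b) = x - y)%R.
Proof. by rewrite opprD addrACA subrr addr0. Qed.

Lemma inord_subn_inj (n l a b : nat) :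
  l <= a -> l <= b -> a <= l + n -> b <= l + n ->
  inord (a - l) = inord (b - l) :> 'I_n.+1 -> a = b.
Proof. by move=> la lb an bn /(congr1 val)/=; rewrite !inordK; lia. Qed.

Lemma exists_mod1_between (N1 N2 : nat) : 0 < N2 <= N1 ->
  exists2 D, D = 1 %[mod N2] & N1 <= D <= N1.*2.
Proof.
(* [D.-1] is the least multiple of [N2] that is at least [N1]. *)
move=> /andP[N20 N21]; exists ((N1.-1 %/ N2).+1 * N2).+1.
  by rewrite -addn1 modnMDl.
have := divn_eq N1.-1 N2; have := ltn_pmod N1.-1 N20.
by rewrite mulSnr; move: (_ * N2) (_ %% N2) => x y; lia.
Qed.

(* Rows are the translates of one template in [F * G]; consecutive rows are
   separated by [n] symbols of a reserved alphabet ['I_n.+1 * F], the [k]-th of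
   which carries the [k]-th letter of a Reed-Solomon encoding of the row. *)
Section Sequence.
Variables (F G : finFieldType) (z1 : F) (z2 : G) (n l D : nat).
Let N1 := #|F|.-1.
Let B := l + n.

Let row (r : nat) : F * G := nth (0%R, 0%R) (enum {: F * G}) r.
Let iota (x : G) : F := nth 0%R (enum F) (enum_rank x).

Let symb (r o : nat) : F * G + 'I_n.+1 * F :=
  if o < l then inl (z1 ^+ o + (row r).1, z2 ^+ ((o * D) %/ N1) + (row r).2)%R
  else inr (inord (o - l), (row r).1 + z1 ^+ (o - l) * iota (row r).2)%R.

Definition row_seq (p : nat) := symb (p %/ B) (p %% B).

Hypothesis (z1P : (N1.-primitive_root z1)%R).
Hypothesis (z2P : ((#|G|.-1).-primitive_root z2)%R).
Hypothesis (lE : l = N1 * #|G|.-1).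
Hypothesis (D1 : D = 1 %[mod #|G|.-1]).
Hypothesis (DN1 : N1 <= D <= N1.*2).
Hypothesis (nN2 : n.*2 < #|G|.-1).
Hypothesis (GF : #|G| <= #|F|).

Let nN1 : n < N1. Proof. by rewrite /N1; lia. Qed.

Let row_inj r r' : r < #|F| * #|G| -> r' < #|F| * #|G| -> row r = row r' -> r = r'.
Proof.
rewrite -card_prod cardE => lr lr' /eqP.
by rewrite /row nth_uniq ?enum_uniq// => /eqP.
Qed.

Let iota_inj : injective iota.
Proof.
move=> x y /eqP; rewrite /iota nth_uniq ?enum_uniq -?cardE//.
- by move/eqP/val_inj/enum_rank_inj.
- by apply: leq_trans (ltn_ord _) _.
- by apply: leq_trans (ltn_ord _) _.
Qed.

(** The values of [b.1 + X * iota b.2] at two distinct points determine both coefficients. *)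
Let pad_inj k k' (b b' : F * G) : k < k' -> k' < n ->
  (b.1 + z1 ^+ k * iota b.2 = b'.1 + z1 ^+ k * iota b'.2)%R ->
  (b.1 + z1 ^+ k' * iota b.2 = b'.1 + z1 ^+ k' * iota b'.2)%R -> b = b'.
Proof.
case: b b' => b1 b2 [b1' b2'] /= kk' k'n e e'.
have {e'} e' : ((z1 ^+ k' - z1 ^+ k) * iota b2 = (z1 ^+ k' - z1 ^+ k) * iota b2')%R.
  rewrite !mulrBl; apply: (addrI (b1 + z1 ^+ k * iota b2)%R).
  by rewrite [in RHS]e [LHS]addrACA [RHS]addrACA e' !subrr.
have nz : (z1 ^+ k' - z1 ^+ k != 0)%R.
  by apply: (subr_prim_expr_neq0 z1P) => //; lia.
have b2E := iota_inj (mulfI nz e').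
by move: e; rewrite b2E => /addIr ->.
Qed.

(** Each symbol lies in a template or a separator. Once the offsets agree, one template symbol or
    two separator symbols identify the row. *)
Lemma row_seq_inj t i j : 0 < t <= n ->
  i + t < #|F| * #|G| * B -> j + t < #|F| * #|G| * B ->
  row_seq i = row_seq j -> row_seq (i + t) = row_seq (j + t) -> i = j.
Proof.
move=> tn iQ jQ.
have nl : n < l by rewrite lE; nia.
have B0 : 0 < B by rewrite /B; lia.
(* As [t <= n <= B], at most one block boundary is crossed. *)
have shift p : row_seq (p + t) = if p %% B + t < B then symb (p %/ B) (p %% B + t)
    else symb (p %/ B).+1 (p %% B + t - B).
  have -> : p + t = p %/ B * B + (p %% B + t) by rewrite addnA -divn_eq.
  rewrite /row_seq divnMDl// modnMDl; case: ltnP => h.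
    by rewrite (divn_small h) (modn_small h) addn0.
  have hB : p %% B + t - B < B.
    rewrite ltn_subLR//; apply: leq_add (ltn_pmod p B0) _.
    by rewrite (leq_trans (andP tn).2)// leq_addl.
  rewrite -[in X in symb X _](subnK h) -[in X in symb _ X](subnK h).
  by rewrite divnDr// modnDr divnn B0 (divn_small hB) (modn_small hB) addn1.
have divQ p : p < #|F| * #|G| * B -> p %/ B < #|F| * #|G| by rewrite ltn_divLR.
have rQ p : p + t < #|F| * #|G| * B -> p %/ B < #|F| * #|G|.
  by move=> pQ; apply: divQ; lia.
have rQ' p : p + t < #|F| * #|G| * B -> B <= p %% B + t -> (p %/ B).+1 < #|F| * #|G|.
  move=> pQ pB; rewrite -(@ltn_pmul2r B)// mulSnr.
  by have := divn_eq p B; lia.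
rewrite !shift /row_seq => e1 e2; rewrite (divn_eq i B) (divn_eq j B).
move: e1 e2.
have := rQ' _ iQ; have := rQ' _ jQ; have := rQ _ iQ; have := rQ _ jQ.
have := ltn_pmod i B0; have := ltn_pmod j B0.
move: (i %/ B) (i %% B) (j %/ B) (j %% B) => r o r' o' {iQ jQ shift divQ rQ rQ'}.
move=> o'B oB rQ' rQ r1Q' r1Q.
have key : o = o' -> row r = row r' -> r * B + o = r' * B + o'.
  by move=> -> /row_inj->.
rewrite {1 2}/symb.
case: ltnP => ol; case: ltnP => ol' //.
- have [_ tn'] := andP tn.
  have otB : o + t < B := leq_add ol tn'.
  have otB' : o' + t < B := leq_add ol' tn'.
  move=> [e1 e2]; rewrite otB otB' /symb; case: ltnP => otl; case: ltnP => otl' //.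
  + move=> [f1 f2].
    (* Taking differences cancels the translation by the row. *)
    have oo' : o = o'.
      apply: (@template_inj F G z1 z2 N1 #|G|.-1 D n t) => //; rewrite -?lE//.
      * by rewrite nN2 /N1 -!subn1 leq_sub2r.
      * by have := congr2 (fun x y => (x - y)%R) f1 e1; rewrite !addrBD.
      * by have := congr2 (fun x y => (x - y)%R) f2 e2; rewrite !addrBD.
    apply: key => //; move: e1 e2; rewrite oo' => /addrI e1 /addrI e2.
    by rewrite [LHS]surjective_pairing e1 e2 -surjective_pairing.
  + move=> [/inord_subn_inj oo' _]; have {}oo' : o = o'.
      by apply/eqP; rewrite -(eqn_add2r t) oo'// leq_add// ltnW.
    apply: key => //; move: e1 e2; rewrite oo' => /addrI e1 /addrI e2.
    by rewrite [LHS]surjective_pairing e1 e2 -surjective_pairing.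
- move=> [/inord_subn_inj oo'].
  have {}oo' : o = o' by apply: oo' => //; exact: ltnW.
  rewrite -{}oo' {ol' o'B} in r1Q' key * => e1.
  case: ltnP => otB.
  + rewrite /symb ltnNge (leq_trans ol (leq_addr _ _)) /= => -[e2].
    apply: key => //; apply: (pad_inj _ _ e1 e2).
      by rewrite -addnBAC// -[X in X < _]addn0 ltn_add2l; case/andP: tn.
    by rewrite ltn_subLR// (leq_trans ol (leq_addr _ _)).
  (* The second symbol lies in the next template and identifies row [r.+1]. *)
  + have otl : o + t - B < l.
      rewrite ltn_subLR// -addSn leq_add//.
      by case/andP: tn => _ /leq_trans; apply; exact: ltnW.
    rewrite /symb otl => -[/addrI f1 /addrI f2].
    have /row_inj : row r.+1 = row r'.+1.
      by rewrite [LHS]surjective_pairing f1 f2 -surjective_pairing.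
    by move=> /(_ (r1Q otB) (r1Q' otB)) [->].
Qed.

End Sequence.

(** For windows of length [n.+1] only distances up to [n] matter, and [n] separators keep letters of
    different templates farther apart than that. *)
Lemma long_robust_seq (F G : finFieldType) (n q : nat) :
  0 < n -> n.*2.+1 < #|G| <= #|F| -> #|F| * (#|G| + n.+1) <= q ->
  exists2 s : seq 'I_q, robust_positioning n.+1 (n.+1 - 1) s &
    size s = #|F| * #|G| * (#|F|.-1 * #|G|.-1 + n).
Proof.
move=> n0 /andP[nG GF] Fq.
have [|z1 z1P] := @finField_prim_root F; first lia.
have [|z2 z2P] := @finField_prim_root G; first lia.
have Aq : #|{: F * G + 'I_n.+1 * F}| <= q.
  rewrite card_sum !card_prod card_ord.
  by apply: leq_trans Fq; rewrite mulnDr [_ * n.+1]mulnC.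
have q0 : 0 < q by lia.
have nN2 : n.*2 < #|G|.-1 by lia.
have N2N1 : 0 < #|G|.-1 <= #|F|.-1 by lia.
have [D D1 DN] := exists_mod1_between N2N1.
pose f (p : nat) : 'I_q :=
  widen_ord Aq (enum_rank (row_seq z1 z2 n (#|F|.-1 * #|G|.-1) D p)).
exists (mkseq f (#|F| * #|G| * (#|F|.-1 * #|G|.-1 + n))); last first.
  by rewrite size_mkseq.
apply: (@robust_of_pairs _ (Ordinal q0)) => t i j /andP[t0 tn] ij.
rewrite size_mkseq => jL.
have iL := ltn_trans (_ : i + t < j + t) jL; rewrite ltn_add2r in iL.
have lt_of p (L : nat) : p + t < L -> p < L.
  by apply: leq_ltn_trans; exact: leq_addr.
rewrite !nth_mkseq ?iL ?jL ?(lt_of _ _ jL) ?(lt_of _ _ (iL ij))//.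
have fE x y : f x = f y -> row_seq z1 z2 n (#|F|.-1 * #|G|.-1) D x =
    row_seq z1 z2 n (#|F|.-1 * #|G|.-1) D y.
  by move=> /(congr1 val)/= /val_inj/enum_rank_inj.
move=> /fE e1 /fE e2; suff ijE : i = j by rewrite ijE ltnn in ij.
apply: (row_seq_inj z1P z2P _ D1 DN nN2 GF _ (iL ij) jL e1 e2) => //.
by rewrite t0 -ltnS.
Qed.

(** * Asymptotics *)

Lemma max_length_ge (q n d : nat) (s : seq 'I_q) : 0 < d ->
  robust_positioning n d s -> size s <= max_length q n d.
Proof. by move=> d0; have [_] := max_lengthP q n d0; exact. Qed.

Lemma max_length_le (q n : nat) : 1 < n -> max_length q n (n - 1) < q ^ 2 + n.
Proof.
move=> n1; have [|[s [rs <-]] _] := @max_lengthP q n (n - 1); first lia.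
exact: robust_size_le.
Qed.

(** A sequence of length [n - 1] has no window. This crude bound keeps the error term of the theorem
    finite. *)
Lemma max_length_ge_pred (q n : nat) : 0 < q -> 1 < n ->
  n - 1 <= max_length q n (n - 1).
Proof.
move=> q0 n1; rewrite -[X in X <= _](size_nseq _ (Ordinal q0)).
apply: max_length_ge; first lia.
by move=> i j ij; rewrite size_nseq; lia.
Qed.

(** The alphabet size costs a factor [(k / k.+1) ^ 4] after squaring, the template length a factor
    [(k.-1 / k) ^ 2]; their product is at least [1 - 6 / k.+1]. *)
Lemma max_length_asymptotic_ge (k : nat) : 4 <= k -> exists K, forall q n, 1 < n ->
  K * n ^ 2 <= q ->
  k.+1 * (q ^ 2 + (n - 1)) <= k.+1 * max_length q n (n - 1) + 6 * q ^ 2.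
Proof.
move=> k4; have [|K KP] := @expn23_approx k; first lia.
exists K => q n n1 Kq; have [|a [b []]] := KP q n _ Kq; first lia.
move=> knb ba abq key.
have b0 : 0 < b by case: b knb {ba abq key} => //; rewrite expn0; nia.
have a0 : 0 < a.
  by case: a ba {abq key} => //; rewrite expn0; move: knb; nia.
have [F _ cF] := @pPrimePowerField 2 a isT a0.
have [G _ cG] := @pPrimePowerField 3 b isT b0.
move: knb ba abq key; rewrite -cF -cG {a b a0 b0 cF cG KP Kq}.
set q1 := #|F|; set q2 := #|G| => kq2 q21 q12 key.
have [|||s rs sz] := @long_robust_seq F G (n - 1) q.
- lia.
- rewrite -/q1 -/q2; apply/andP; split=> //.
  by apply: leq_ltn_trans kq2; have := leq_mul k4 (leqnn n); lia.
- by rewrite -/q1 -/q2; have -> : (n - 1).+1 = n by lia.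
have {rs} : size s <= max_length q n (n - 1).
  apply: max_length_ge; first lia.
  by move: rs; have -> : (n - 1).+1 = n by lia.
rewrite sz -/q1 -/q2 {s sz}; move: (max_length _ _ _) => L.
rewrite mulnDr => hL.
have {kq2} kq2 : k <= q2.
  by apply: leq_trans (ltnW kq2); rewrite leq_pmulr; lia.
have kq1 := leq_trans kq2 q21.
have pred_le x : k <= x -> k.-1 * x <= k * x.-1 by nia.
have hN : k.-1 ^ 2 * (q1 * q2) <= k ^ 2 * (q1.-1 * q2.-1).
  by have := leq_mul (pred_le _ kq1) (pred_le _ kq2); rewrite -!mulnn; lia.
have Q0 : 0 < q1 * q2 by rewrite muln_gt0; lia.
have n1L : n - 1 <= q1 * q2 * (n - 1) by rewrite leq_pmull.
move: hN Q0 key n1L hL; move: (q1 * q2) (q1.-1 * q2.-1) => Q N hN Q0 key n1L hL.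
suff h : k.+1 * q ^ 2 <= k.+1 * (Q * N) + 6 * q ^ 2.
  by have := leq_mul (leqnn k.+1) (leq_trans (leq_add (leqnn (Q * N)) n1L) hL); lia.
have {hN} h1 : k.-1 ^ 2 * Q ^ 2 <= k ^ 2 * (Q * N).
  by have := leq_mul hN (leqnn Q); rewrite -[Q ^ 2]mulnn; lia.
have {key} h2 : k ^ 4 * q ^ 2 <= k.+1 ^ 4 * Q ^ 2.
  by have := leq_mul key key; rewrite !mulnn 2!expnMn -!expnM.
have h3 : k.-1 ^ 2 * k ^ 2 * q ^ 2 <= k.+1 ^ 4 * (Q * N).
  rewrite -(@leq_pmul2l (k ^ 2)) ?expn_gt0 ?(leq_trans _ k4)//.
  have := leq_mul (leqnn (k.-1 ^ 2)) h2.
  have := leq_mul (leqnn (k.+1 ^ 4)) h1.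
  rewrite [k ^ 4](expnD k 2 2).
  by move: (k.-1 ^ 2) (k ^ 2) (k.+1 ^ 4) (Q ^ 2) (q ^ 2) => *; lia.
rewrite -(@leq_pmul2l (k.+1 ^ 3)) ?expn_gt0//.
have h4 : k.+1 ^ 4 <= k.-1 ^ 2 * k ^ 2 + 6 * k.+1 ^ 3.
  by case: k k4 {h1 h2 h3 hL pred_le kq1 kq2} => // k _; rewrite /= !expnS expn0; nia.
have := leq_mul h4 (leqnn (q ^ 2)).
move: h3; rewrite [k.+1 ^ 4]expnSr.
move: (k.-1 ^ 2 * k ^ 2) (k.+1 ^ 3) (q ^ 2) (Q * N).
by clear; move=> *; lia.
Qed.

Local Open Scope classical_set_scope.
Local Open Scope ring_scope.

(** For [n >= A] one has [c * n ^ eps >= K]; the finitely many smaller [n] are covered by taking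
    [q0] large. *)
Lemma natr_powR_superquadratic (R : realType) (c eps : R) (K : nat) :
  0 < c -> 0 < eps -> exists q0 : nat, forall n q : nat, (0 < n)%N ->
  (q0 <= q)%N -> c * n%:R `^ (2 + eps) <= q%:R -> (K * n ^ 2 <= q)%N.
Proof.
move=> c0 eps0; pose A : R := (K%:R / c) `^ eps^-1.
exists (K * (Num.truncn A).+1 ^ 2)%N => n q n0 q0q hq.
have [An|nA] := leP A n%:R; last first.
  apply: leq_trans q0q; rewrite leq_mul2l leq_exp2r//.
  apply/orP; right; rewrite -(ler_nat R).
  by apply: ltW; apply: lt_trans nA _; rewrite truncnS_gt.
rewrite -(ler_nat R) natrM natrX (le_trans _ hq)//.
have nn0 : n%:R != 0 :> R by rewrite pnatr_eq0 -lt0n.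
rewrite powRD ?nn0 ?implybT// powR_mulrn//.
rewrite [in leRHS]mulrCA [leLHS]mulrC; apply: ler_wpM2l; first exact: exprn_ge0.
rewrite mulrC -ler_pdivrMr//.
have -> : K%:R / c = A `^ eps.
  by rewrite -powRrM mulVf ?gt_eqF// powRr1// divr_ge0// ltW.
by apply: ge0_ler_powR; rewrite ?nnegrE ?powR_ge0// ltW.
Qed.

Theorem corollary8p6 (R : realType) (c eps : R) (hc : 0 < c) (heps : 0 < eps) :
  exists err : nat -> R,
    ((err : nat -> R^o) =o_\oo (fun q : nat => q%:R ^+ 2 : R^o)) /\
    forall n q : nat, (2 <= n)%N -> c * n%:R `^ (2 + eps) <= q%:R ->
      q%:R ^+ 2 + n%:R - 1 - err q <= (max_length q n (n - 1))%:R /\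
      (max_length q n (n - 1))%:R <= q%:R ^+ 2 + n%:R - 1 :> R.
Proof.
pose gap (q n : nat) : R := q%:R ^+ 2 + n%:R - 1 - (max_length q n (n - 1))%:R.
(* The error may depend on [q] only, so it is the supremum of the gaps over all admissible [n]. *)
pose gaps (q : nat) : set R := [set gap q n | n in
  [set n : nat | (2 <= n)%N /\ c * n%:R `^ (2 + eps) <= q%:R]].
have gap_ge0 q n : (2 <= n)%N -> 0 <= gap q n.
  move=> n2; have := max_length_le q n2; rewrite -(ler_nat R) natrD natrX.
  by rewrite -natr1 /gap; lra.
have gaps_ub q : ubound (gaps q) (q%:R ^+ 2).
  move=> _ [n [n2 nq] <-].
  have q0 : (0 < q)%N.
    rewrite -(ltr_nat R) (lt_le_trans _ nq)// mulr_gt0// powR_gt0// ltr0n.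
    exact: ltnW.
  have := max_length_ge_pred q0 n2; rewrite -(ler_nat R) natrB ?(ltnW n2)//.
  by rewrite /gap; lra.
exists (fun q => sup (gaps q)); split; last first.
  move=> n q n2 nq; split; last by have := gap_ge0 q n n2; rewrite /gap; lra.
  have : gap q n <= sup (gaps q).
    by apply: ub_le_sup; [exists (q%:R ^+ 2)|exists n].
  by rewrite /gap; lra.
apply/eqoP => d d0.
(* This makes the relative loss [6 / k.+1] at most [d] and ensures [4 <= k]. *)
pose k := (Num.truncn (6 / d) + 4)%N.
have k6 : 6 <= d * k.+1%:R.
  rewrite mulrC -ler_pdivrMr// ltW// (lt_le_trans (truncnS_gt _))//.
  by rewrite ler_nat ltnS leq_addr.
have [|K KP] := @max_length_asymptotic_ge k; first exact: leq_addl.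
have [q0 q0P] := natr_powR_superquadratic K hc heps.
exists q0 => // q /= q0q.
have gap_le n : (2 <= n)%N -> c * n%:R `^ (2 + eps) <= q%:R ->
    gap q n <= d * q%:R ^+ 2.
  move=> n2 nq; have Kn := q0P n q (ltnW n2) q0q nq.
  have := KP q n n2 Kn; rewrite -(ler_nat R) natrD !natrM natrD natrX.
  rewrite natrB ?(ltnW n2)// => h.
  rewrite -(@ler_pM2l _ k.+1%:R)// /gap.
  have : 6 * q%:R ^+ 2 <= d * k.+1%:R * q%:R ^+ 2 by rewrite ler_wpM2r ?exprn_ge0.
  by move: h; nra.
have dq0 : 0 <= d * q%:R ^+ 2 by rewrite mulr_ge0 ?exprn_ge0// ltW.
rewrite [X in _ <= _ * X]ger0_norm ?exprn_ge0//.
have [->|ne] := eqVneq (gaps q) set0; first by rewrite sup0 normr0.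
have /set0P[_ [n [n2 nq] _]] := ne.
rewrite ger0_norm.
  apply: ge_sup; first exact/set0P.
  by move=> _ [m [m2 mq] <-]; exact: gap_le.
apply: le_trans (gap_ge0 q n n2) _; apply: ub_le_sup; last by exists n.
by exists (q%:R ^+ 2).
Qed.
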